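(* The mapping $J$ is not Lipschitz continuous around $u^*$, i.e., there does not exist a constant $C>0$ such that $$\Vert J(u_1)-J(u_2)\Vert_{\mathbb{V}}\le C\Vert u_1-u_2\Vert_{\mathbb{U}},\qquad \forall u_1,u_2\in\mathbb{U}\setminus\{u^*\}.$$
   Context: Let $\mathbb{U}$ and $\mathbb{V}$ be real Hilbert spaces, let $\mathbb{V}'$ be the topological dual of $\mathbb{V}$ with norm $\Vert \ell\Vert_{\mathbb{V}'}=\sup_{\Vert v\Vert_{\mathbb{V}}=1}\ell(v)$, let $b:\mathbb{U}\times\mathbb{V}\to\mathbb{R}$ be a bilinear form, and let $l\in\mathbb{V}'$. Let $B:\mathbb{U}\to\mathbb{V}'$ be defined by $(Bu)(v):=b(u,v)$. Standing assumptions: $\{v\in\mathbb{V}: b(u,v)=0\ \forall u\in\mathbb{U}\}=\{0\}$, and there exist constants $M\ge\gamma>0$ such that $\gamma\Vert u\Vert_{\mathbb{U}}\le\Vert Bu\Vert_{\mathbb{V}'}\le M\Vert u\Vert_{\mathbb{U}}$ for all $u\in\mathbb{U}$. Under these assumptions there is a unique $u^*\in\mathbb{U}$ with $Bu^*=l$; $u^*$ denotes this element. The mapping $J:\mathbb{U}\setminus\{u^*\}\to\mathbb{V}$ assigns to each $u\neq u^*$ the (unique) maximizer of the residual $Bu-l\in\mathbb{V}'$ over the unit sphere of $\mathbb{V}$: $$J(u):=\arg\max_{\Vert v\Vert_{\mathbb{V}}=1}(Bu-l)(v).$$ *)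

(* Defs.v *)
From HB Require Import structures.
From mathcomp Require Import all_boot all_order all_algebra.
From mathcomp Require Import all_classical all_reals all_analysis.

Set Implicit Arguments.
Unset Strict Implicit.
Unset Printing Implicit Defensive.

Import Order.TTheory GRing.Theory Num.Theory.
Import numFieldNormedType.Exports.

Local Open Scope classical_set_scope.
Local Open Scope ring_scope.

HB.mixin Record NormedModule_hasInner (R : realType) V of NormedModule R V := {
  inner : {dot V for @idfun R};
  inner_normE : forall v : V, inner v v = `|v| ^+ 2
}.

#[short(type="hilbertType")]
HB.structure Definition Hilbert (R : realType) :=
  {V of CompleteNormedModule R V & NormedModule_hasInner R V}.

Section DualNormArgmax.
Variables (R : realType) (V : hilbertType R).

Definition unit_sphere : set V := [set v | `|v| = 1].

(* The supremum is taken in the extended reals: for a linear form [f] it is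
   [+oo] if [f] is unbounded, and it is [-oo] over the zero space, whose unit
   sphere is empty. *)
Definition dual_norm (f : V -> R) : \bar R :=
  ereal_sup [set (f v)%:E | v in unit_sphere].

Definition maximizers (f : V -> R) : set V :=
  [set v | unit_sphere v /\ forall w, unit_sphere w -> f w <= f v].

(* For a nonzero continuous linear [f] there is exactly one maximizer; the
   default value [0] is returned only if there is none. *)
Definition argmax_sphere (f : V -> R) : V := xget 0 (maximizers f).

End DualNormArgmax.

Section ResidualMaximizer.
Variables (R : realType) (U V : hilbertType R).

Definition residual (b : {bilinear U -> V -> R^o}) (l : {linear V -> R^o})
  (u : U) : V -> R := fun v => b u v - l v.

(* Relevant only where the residual is nonzero; elsewhere every point of the
   sphere is a maximizer and the value is an arbitrary one of them. *)
Definition residual_argmax (b : {bilinear U -> V -> R^o})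
  (l : {linear V -> R^o}) (u : U) : V := argmax_sphere (residual b l u).

End ResidualMaximizer.

(* Main.v *)
Require Import Defs.
From HB Require Import structures.
From mathcomp Require Import all_boot all_order all_algebra.
From mathcomp Require Import all_classical all_reals all_analysis.
From mathcomp Require Import ring lra.

Import Order.TTheory GRing.Theory Num.Theory.
Import numFieldNormedType.Exports.

Local Open Scope classical_set_scope.
Local Open Scope ring_scope.

(** The map [J] jumps across [ustar].  For [u != 0] the residuals at
    [ustar + u] and [ustar - u] are the opposite functionals [b u] and [- b u].
    A maximizer [v1] of [b u] and a maximizer [v2] of [- b u] on the unit sphere
    satisfy [b u (v1 - v2) = 2 N], where [N > 0] is the dual norm of [b u], and
    [b u (v1 - v2) <= N * `|v1 - v2|]; hence [`|v1 - v2| >= 2]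
    ([argmax_sphere_opp_gap]).  The points [ustar + u] and [ustar - u] are at
    distance [2 * `|u|], which is arbitrarily small, so no Lipschitz constant
    can exist.  Uniqueness of the maximizer plays no role.

    Its existence does ([norming_vector_exists]): by the parallelogram identity,
    the slices [{v | `|v| = 1, f v > N - e}] of the sphere have diameter tending
    to 0 with [e], so they generate a Cauchy filter, whose limit is a unit
    vector at which [f] equals [N]. *)

Lemma parallelogram {R : realType} {V : hilbertType R} (x y : V) :
  `|x + y| ^+ 2 + `|x - y| ^+ 2 = 2 * (`|x| ^+ 2 + `|y| ^+ 2).
Proof.
rewrite -!inner_normE linearDl linearBl !linearDr !linearNr /=; ring.
Qed.

Lemma argmax_sphereP {R : realType} {V : hilbertType R} (g : V -> R) :
  maximizers g !=set0 -> maximizers g (argmax_sphere g).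
Proof. exact: xgetPex. Qed.

Section NormingVector.
Context {R : realType} {V : hilbertType R} {f : {linear V -> R^o}} {N : R}.
Hypothesis fN : dual_norm f = N%:E.

Lemma le_dual_norm_sphere (w : V) : `|w| = 1 -> f w <= N.
Proof.
by move=> w1; rewrite -lee_fin -fN; apply: ereal_sup_ubound; exists w.
Qed.

Lemma le_dual_norm (w : V) : f w <= N * `|w|.
Proof.
have [->|w0] := eqVneq w 0; first by rewrite linear0 normr0 mulr0.
have nw0 : 0 < `|w| by rewrite normr_gt0.
have /le_dual_norm_sphere : `| `|w|^-1 *: w| = 1.
  by rewrite normrZ normfV normr_id mulVf ?gt_eqF.
by rewrite linearZ /= /GRing.scale /= mulrC ler_pdivrMr.
Qed.

(** The part of the unit sphere on which [f] is within [e] of its supremum. *)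
Definition sphere_slice (e : R) : set V := [set v | `|v| = 1 /\ N - e < f v].

Lemma sphere_slice_nonempty (e : R) : 0 < e -> sphere_slice e !=set0.
Proof.
move=> e0.
have : ((N - e)%:E < dual_norm f)%E by rewrite fN lte_fin; lra.
by move=> /ereal_sup_gt[_ [v v1 <-]]; rewrite lte_fin => fv; exists v.
Qed.

(** The diameter of a slice is controlled by the uniform convexity of the
    Hilbert norm. *)
Lemma sphere_slice_diam (e : R) (x y : V) : 0 < N ->
  sphere_slice e x -> sphere_slice e y -> N * `|x - y| ^+ 2 <= 8 * e.
Proof.
move=> N0 [x1 fx] [y1 fy].
have := parallelogram x y; rewrite x1 y1.
have := le_dual_norm (x + y); rewrite linearD /=.
have := ler_normD x y; rewrite x1 y1.
have := normr_ge0 (x + y).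
move: `|x + y| `|x - y| => s d s0 s2 Ns sd.
have -> : d ^+ 2 = 4 - s ^+ 2 by lra.
have Ns2 : N * (2 - s) <= 2 * e by lra.
have -> : N * (4 - s ^+ 2) = N * (2 - s) * (2 + s) by ring.
have : 0 <= N * (2 - s) by apply: mulr_ge0; lra.
nra.
Qed.

(** The filter generated by the slices; when [N > 0] it converges to a unit
    vector at which [f] equals [N]. *)
Definition slice_filter : set_system V :=
  filter_from [set e : R | 0 < e] sphere_slice.

Lemma slice_filter_proper : ProperFilter slice_filter.
Proof.
apply: filter_from_proper; last exact: sphere_slice_nonempty.
apply: filter_from_filter; first by exists 1; exact: ltr01.
move=> i j i0 j0; exists (Num.min i j); first by rewrite /= lt_min i0.
move=> v [v1 fv]; have mi : Num.min i j <= i by rewrite ge_min lexx.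
have mj : Num.min i j <= j by rewrite ge_min lexx orbT.
by split; split=> //; lra.
Qed.

Lemma slice_filter_cauchy : 0 < N -> cauchy slice_filter.
Proof.
move=> N0; have pF := slice_filter_proper; apply: cauchy_exP => e e0.
(* With this [d], [sphere_slice_diam] gives [`|x - y| ^+ 2 <= e ^+ 2 / 2]. *)
pose d := N * e ^+ 2 / 16.
have d0 : 0 < d by rewrite divr_gt0// mulr_gt0// exprn_gt0.
have [x xd] := sphere_slice_nonempty d d0.
exists x, d => // y yd; rewrite -ball_normE /ball_ /=.
have := sphere_slice_diam d x y N0 xd yd.
rewrite -(ltr_pXn2r (n := 2)) ?nnegrE// ?(ltW e0)//.
have e20 : 0 < e ^+ 2 by rewrite exprn_gt0.
have -> : 8 * d = N * (e ^+ 2 / 2) by rewrite /d; field.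
rewrite ler_pM2l//; lra.
Qed.

Lemma norming_vector_exists : 0 < N -> exists2 v : V, `|v| = 1 & f v = N.
Proof.
move=> N0; have pF := slice_filter_proper.
have /cauchy_cvgP/cvg_ex[v Fv] := slice_filter_cauchy N0.
have near_v (e : R) : 0 < e ->
    exists x, [/\ `|x| = 1, N - e < f x & `|v - x| < e].
  move=> e0; have : slice_filter (sphere_slice e `&` ball v e).
    by apply: filterI; [exists e | apply: Fv; exact: nbhsx_ballx].
  move=> /filter_ex[x [[x1 fx]]]; rewrite -ball_normE => vx.
  by exists x.
have v1 : `|v| = 1.
  apply/eqP; rewrite -subr_eq0 -normr_le0; apply/ler_addgt0Pr => e e0.
  have [x [x1 _ vx]] := near_v e e0; rewrite add0r -x1.
  exact: le_trans (ler_dist_dist _ _) (ltW vx).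
exists v => //; apply/eqP; rewrite eq_le le_dual_norm_sphere//=.
apply/ler_addgt0Pr => e e0.
have [|x [x1 fx vx]] := near_v (e / (1 + N)).
  by apply: divr_gt0 => //; lra.
have := le_dual_norm (x - v); rewrite linearB /= distrC => fxv.
have : N * `|v - x| <= N * (e / (1 + N)) by rewrite ler_pM2l// ltW.
have : e = e / (1 + N) + N * (e / (1 + N)) by field; lra.
lra.
Qed.

Lemma argmax_sphere_opp_gap : 0 < N ->
  2 <= `|argmax_sphere f - argmax_sphere (fun v => - f v)|.
Proof.
move=> N0; have [v v1 fv] := norming_vector_exists N0.
have vN1 : `|- v| = 1 by rewrite normrN.
have fNv : f (- v) = - N by rewrite linearN fv.
have [|_ /(_ v v1)] := argmax_sphereP f.
  by exists v; split => // w /le_dual_norm_sphere; rewrite fv.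
have [|_ /(_ (- v) vN1)] := argmax_sphereP (fun v => - f v).
  exists (- v); split => // w w1; rewrite fNv opprK -linearN.
  by apply: le_dual_norm_sphere; rewrite normrN.
rewrite fv fNv opprK.
set v1' := argmax_sphere f; set v2 := argmax_sphere _ => fv2 fv1.
have := le_dual_norm (v1' - v2); rewrite linearB /= => le_gap.
rewrite -(ler_pM2l N0); lra.
Qed.

End NormingVector.

Theorem proposition2 (R : realType) (U V : hilbertType R)
  (b : {bilinear U -> V -> R^o})
  (l : {linear V -> R^o}) (l_cont : continuous l)
  (b_nondeg : [set v : V | forall u : U, b u v = 0] = [set 0])
  (gamma M : R) (gamma_gt0 : 0 < gamma) (le_gamma_M : gamma <= M)
  (B_bounds : forall u : U,
     ((gamma * `|u|)%:E <= dual_norm (b u) /\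
      dual_norm (b u) <= (M * `|u|)%:E)%E)
  (ustar : U) (ustarE : forall v : V, b ustar v = l v) :
  ~ (exists2 C : R, 0 < C &
     forall u1 u2 : U, u1 != ustar -> u2 != ustar ->
       `|residual_argmax b l u1 - residual_argmax b l u2| <= C * `|u1 - u2|).
Proof.
move=> [C C0 lipJ].
(* The lower bound at [u = 0] forces the unit sphere of [V] to be nonempty,
   since the supremum over the empty set is [-oo]. *)
have [v0 v01] : exists v0 : V, `|v0| = 1.
  apply: contrapT => noV; have [+ _] := B_bounds 0.
  rewrite normr0 mulr0 /dual_norm (_ : [set _ | _ in _] = set0).
    by rewrite ereal_sup0 leeNy_eq.
  by apply/seteqP; split => // y [v v1 _]; apply: noV; exists v.
have [u0 u0N0] : exists u0 : U, u0 != 0.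
  apply: contrapT => noU.
  have : [set v : V | forall u : U, b u v = 0] v0.
    move=> u; have [->|uN0] := eqVneq u 0; first by rewrite linear0l.
    by case: noU; exists u.
  by rewrite b_nondeg => /= v00; move: v01; rewrite v00 normr0 => /eqP;
     rewrite eq_sym oner_eq0.
have jump (u : U) : u != 0 -> 2 <= C * (2 * `|u|).
  move=> uN0; have nu0 : 0 < `|u| by rewrite normr_gt0.
  have [loB upB] := B_bounds u.
  have fin : dual_norm (b u) \is a fin_num.
    by rewrite fin_numElt (lt_le_trans (ltNyr _) loB) (le_lt_trans upB (ltry _)).
  have N0 : 0 < fine (dual_norm (b u)).
    rewrite -lte_fin fineK//; apply: lt_le_trans loB.
    by rewrite lte_fin mulr_gt0.
  have residualD : residual b l (ustar + u) = b u.
    by apply/funext => v; rewrite /residual linearDl ustarE addrC addKr.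
  have residualB : residual b l (ustar - u) = (fun v => - b u v).
    by apply/funext => v; rewrite /residual linearBl ustarE addrAC subrr add0r.
  have neD : ustar + u != ustar by rewrite -subr_eq0 addrAC subrr add0r.
  have neB : ustar - u != ustar.
    by rewrite -subr_eq0 addrAC subrr add0r oppr_eq0.
  have distDB : ustar + u - (ustar - u) = 2 *: u.
    by rewrite opprB addrC addrA subrK scaler_nat.
  have := lipJ _ _ neD neB; rewrite /residual_argmax residualD residualB distDB.
  rewrite normrZ ger0_norm//; apply: le_trans.
  exact: (argmax_sphere_opp_gap (esym (fineK fin))).
have nu0 : 0 < `|u0| by rewrite normr_gt0.
(* The multiple [u] of [u0] of norm [1 / (2 * C)] has [C * (2 * `|u|) = 1]. *)
have c0 : 0 < (2 * C * `|u0|)^-1 by rewrite invr_gt0 !mulr_gt0.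
have := jump ((2 * C * `|u0|)^-1 *: u0).
rewrite scaler_eq0 negb_or gt_eqF// u0N0 => /(_ isT).
rewrite normrZ gtr0_norm// (_ : C * _ = 1); first lra.
by field; rewrite !gt_eqF.
Qed.
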